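(* Let $m,s,p,n$ be nonnegative integers with $n\geq p$ and $m\geq 1$, and let $x$ be a complex number with $x\neq -1,-2,\ldots$. Then $$ \sum_{k=p}^{n} (-1)^{k-1}\binom{n}{k}\binom{k}{p} H_{mk+s}(x)= \begin{cases} \dfrac{(-1)^{p}\,m^{n-p-1}\,n!}{(n-p)\,p!}\displaystyle\sum_{i=1}^{m}\frac{1}{\prod_{u=p}^{n-1}(mu+s+x+i)}, & n>p,\\[12pt] (-1)^{p-1}H_{mp+s}(x), & n=p. \end{cases} $$
   Context: For an integer $n\geq 1$ and $x\neq -1,-2,\ldots$, define $H_n(x)=\sum_{k=1}^{n}\frac{1}{k+x}$; for $n\leq 0$ set $H_n(x)=0$. *)

(* Defs.v *)
From HB Require Import structures.
From mathcomp Require Import all_boot all_order all_algebra.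
From mathcomp Require Import reals complex.

Set Implicit Arguments.
Unset Strict Implicit.
Unset Printing Implicit Defensive.

Import Order.TTheory GRing.Theory Num.Theory.

Local Open Scope ring_scope.
Local Open Scope complex_scope.

(* H_n(x); the sum is empty for n = 0. *)
Definition shifted_harmonic (R : realType) (n : int) (x : R[i]) : R[i] :=
  match n with
  | Posz n' => \sum_(1 <= k < n'.+1) (k%:R + x)^-1
  | Negz _ => 0
  end.

(* Main.v *)
Require Import Defs.
From HB Require Import structures.
From mathcomp Require Import all_boot all_order all_algebra.
From mathcomp Require Import reals complex.
From mathcomp Require Import ring.

(** Since 'C(n, k) 'C(k, p) = 'C(n, p) 'C(n - p, k - p), the left-hand side is,
    up to sign and the factor 'C(n, p), the (n - p)-th finite difference at 0 of
    j |-> H_(m (p + j) + s)(x).  One difference turns the harmonic number into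
    the sum over 1 <= i <= m of 1 / (m (p + j) + s + x + i), and the remaining
    n - p - 1 differences of j |-> 1 / (a + j m) are given by the partial
    fraction expansion of 1 / prod_j (a + j m). *)

Set Implicit Arguments.
Unset Strict Implicit.
Unset Printing Implicit Defensive.

Import Order.TTheory GRing.Theory Num.Theory.

Local Open Scope ring_scope.
Local Open Scope complex_scope.

(** Pascal's rule splits ['C(M.+1, j.+1)]; this peels one difference off an alternating sum of order
    [M.+1]. *)
Lemma alternating_binomial_sumS (R : pzRingType) (M : nat) (f : nat -> R) :
  \sum_(j < M.+2) (-1) ^+ j * 'C(M.+1, j)%:R * f j
  = \sum_(j < M.+1) (-1) ^+ j * 'C(M, j)%:R * (f j - f j.+1).
Proof.
under [RHS]eq_bigr do rewrite mulrBr.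
rewrite sumrB.
(* The added term vanishes because ['C(M, M.+1)] is 0. *)
have -> : \sum_(j < M.+1) (-1) ^+ j * 'C(M, j)%:R * f j
        = \sum_(j < M.+2) (-1) ^+ j * 'C(M, j)%:R * f j.
  by rewrite [RHS]big_ord_recr /= bin_small // mulr0 mul0r addr0.
rewrite big_ord_recl [X in _ = X - _]big_ord_recl !bin0 -addrA; congr (_ + _).
rewrite -sumrB; apply: eq_bigr => j _.
by rewrite /= /bump /= add1n binS natrD mulrDr mulrDl exprS !mulN1r !mulNr.
Qed.

(** By induction: the sum for [M.+1] is the difference of the sums for [M] started at [a] and at
    [a + d]. The two products differ only in their end factors, whose difference is
    [M.+1%:R * d]. *)
Lemma alternating_binomial_sum_inv (F : fieldType) (M : nat) (a d : F) :
  (forall j, (j <= M)%N -> a + j%:R * d != 0) ->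
  \sum_(j < M.+1) (-1) ^+ j * 'C(M, j)%:R * (a + j%:R * d)^-1
  = (M`!)%:R * d ^+ M / \prod_(j < M.+1) (a + j%:R * d).
Proof.
elim: M a => [|M IH] a nz.
  by rewrite !big_ord1 fact0 !expr0 bin0 !mul1r.
rewrite (alternating_binomial_sumS M (fun j => (a + j%:R * d)^-1)).
under eq_bigr do rewrite mulrBr.
rewrite sumrB IH => [|j lejM]; last exact/nz/leqW.
have shift j : a + j.+1%:R * d = (a + d) + j%:R * d.
  by rewrite -natr1; ring.
under [X in _ - X]eq_bigr do rewrite shift.
rewrite IH => [|j lejM]; last by rewrite -shift nz.
(* All three products are written through [a], the last factor and the common middle product, so
   that [field] can conclude. *)
rewrite [in RHS]big_ord_recl big_ord_recl /=.
under [X in _ = _ / (_ * X)]eq_bigr do rewrite /bump /= add1n shift.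
under [X in _ / (_ * X) - _]eq_bigr do rewrite /bump /= add1n shift.
rewrite !big_ord_recr /= mul0r addr0 factS natrM exprS.
have a_nz : a != 0 by have := nz 0 (leq0n _); rewrite mul0r addr0.
have last_nz : a + d + M%:R * d != 0 by rewrite -shift nz.
have prod_nz : \prod_(i < M) (a + d + i%:R * d) != 0.
  by apply/prodf_neq0 => i _; rewrite -shift nz // ltnS ltnW.
rewrite -natr1.
by field; rewrite a_nz prod_nz last_nz.
Qed.

(** Multiplied by p! j! (n - p - j)!, both sides become n!. *)
Lemma bin_mul_bin (n p j : nat) : (p + j <= n)%N ->
  ('C(n, p + j) * 'C(p + j, p) = 'C(n, p) * 'C(n - p, j))%N.
Proof.
move=> lepjn.
have lepn : (p <= n)%N := leq_trans (leq_addr _ _) lepjn.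
have lejnp : (j <= n - p)%N by rewrite leq_subRL.
apply/eqP; rewrite -(eqn_pmul2r (fact_gt0 p)) -(eqn_pmul2r (fact_gt0 j)).
rewrite -(eqn_pmul2r (fact_gt0 (n - (p + j)))); apply/eqP.
have E1 := bin_fact lepjn; have E2 := bin_fact (leq_addr j p).
have E3 := bin_fact lepn; have E4 := bin_fact lejnp.
rewrite addKn in E2; rewrite -subnDA in E4.
transitivity n`!; first by rewrite -E1 -E2; ring.
by rewrite -E3 -E4; ring.
Qed.

Lemma exprzN1_pred (F : fieldType) (k : nat) :
  (-1 : F) ^ (k%:Z - 1) = - (-1) ^+ k.
Proof.
by rewrite expfzDr ?oppr_eq0 ?oner_eq0 // exprN1 invrN1 mulrN1.
Qed.

Lemma shifted_harmonic_addn (R : realType) (a m : nat) (x : R[i]) :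
  shifted_harmonic (a + m)%N%:Z x
  = shifted_harmonic a%:Z x + \sum_(1 <= i < m.+1) ((a + i)%:R + x)^-1.
Proof.
rewrite /shifted_harmonic; elim: m => [|m IH]; first by rewrite addn0 [X in _ = _ + X]big_geq ?addr0.
by rewrite addnS big_nat_recr //= IH [X in _ = _ + X]big_nat_recr //= addnS addrA.
Qed.

Theorem theorem1p2 (R : realType) (m s p n : nat) (x : R[i])
  (hpn : (p <= n)%N) (hm : (1 <= m)%N)
  (hx : forall j : nat, (1 <= j)%N -> x <> - j%:R) :
  \sum_(p <= k < n.+1)
     (-1) ^ (k%:Z - 1) * 'C(n, k)%:R * 'C(k, p)%:R
       * shifted_harmonic (m * k + s)%N%:Z x
  = if (p < n)%N then
      (-1) ^+ p * m%:R ^+ (n - p - 1) * (n`!)%:R / ((n - p)%:R * (p`!)%:R)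
        * \sum_(1 <= i < m.+1)
            (\prod_(p <= u < n) ((m * u)%:R + s%:R + x + i%:R))^-1
    else (-1) ^ (p%:Z - 1) * shifted_harmonic (m * p + s)%N%:Z x.
Proof.
case: ltnP => [ltpn | lenp]; last first.
  have -> : n = p by apply/eqP; rewrite eqn_leq lenp.
  by rewrite big_nat1 !binn !mulr1.
have [M defn] : exists M, n = (p + M.+1)%N.
  by exists (n - p).-1; rewrite prednK ?subn_gt0 // subnKC.
rewrite {}defn {n hpn ltpn}.
have nz j : (1 <= j)%N -> j%:R + x != 0.
  by move=> j_gt0; rewrite addrC addr_eq0; apply/eqP/hx.
pose H j := shifted_harmonic (m * (p + j) + s)%N%:Z x.
(* For fixed [i], the denominators form the arithmetic progression with first term [a i] and step
   [m]. *)
pose a i : R[i] := (m * p + s + i)%N%:R + x.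
have dH j : H j - H j.+1 = - \sum_(1 <= i < m.+1) (a i + j%:R * m%:R)^-1.
  rewrite /H addnS mulnS -addnA [(m + _)%N]addnC (shifted_harmonic_addn (_ + s)).
  rewrite opprD addrA subrr sub0r; congr (- _); apply: eq_bigr => i _; congr (_^-1).
  by rewrite /a mulnDr !natrD natrM; ring.
rewrite -[p in LHS]add0n big_addn big_mkord.
have -> : ((p + M.+1).+1 - p = M.+2)%N by rewrite -addnS addKn.
(* With k = p + j, the sign (-1)^(k-1) is -(-1)^p (-1)^j; the leading minus later cancels the one in
   [dH]. *)
transitivity (- (-1) ^+ p * 'C(p + M.+1, p)%:R
                * \sum_(j < M.+2) (-1) ^+ j * 'C(M.+1, j)%:R * H j).
  rewrite mulr_sumr; apply: eq_bigr => j _.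
  rewrite exprzN1_pred addnC -/(H j) exprD -[_ * _ * 'C(_, p)%:R]mulrA -natrM.
  rewrite bin_mul_bin; last by rewrite leq_add2l -ltnS.
  by rewrite addKn natrM; ring.
rewrite (alternating_binomial_sumS M H).
under eq_bigr do rewrite dH mulrN mulr_sumr.
rewrite sumrN exchange_big /= mulrN !mulNr opprK !mulr_sumr.
apply: eq_big_nat => i /andP[i_gt0 _].
rewrite alternating_binomial_sum_inv => [|j _]; last first.
  (* Each factor is a natural number plus [x], and that number is positive because [i] is at least
     1. *)
  rewrite /a addrAC -natrM -natrD; apply: nz.
  by rewrite addn_gt0 addn_gt0 i_gt0 orbT.
have -> : \prod_(j < M.+1) (a i + j%:R * m%:R)
        = \prod_(p <= u < p + M.+1) ((m * u)%:R + s%:R + x + i%:R).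
  rewrite -[p in RHS]add0n big_addn addKn big_mkord; apply: eq_bigr => j _.
  by rewrite /a mulnDr !natrD !natrM; ring.
rewrite addKn subn1 /=.
have fact_nz k : k`!%:R != 0 :> R[i] by rewrite pnatr_eq0 -lt0n fact_gt0.
have M1_nz : M.+1%:R != 0 :> R[i] by rewrite pnatr_eq0.
(* Splitting (n - p)! as [M.+1] times M! explains the denominator n - p: 'C(n, p) M! = n! / ((n - p)
   p!). *)
have <- : 'C(p + M.+1, p)%:R * (p`!%:R * (M.+1%:R * M`!%:R)) = (p + M.+1)`!%:R :> R[i].
  by rewrite -!natrM -factS -{2}(addKn p M.+1) bin_fact ?leq_addr.
rewrite [LHS]mulrA; congr (_ * _).
by field; rewrite fact_nz nat1r M1_nz.
Qed.
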